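(* For every Brouwer code $b:\mathrm B$, (1) the ordinal $[\![b]\!]_{\Sigma_1}$ is trichotomous; (2) the underlying type of $[\![b]\!]_{\Sigma_1}$ is a retract of $\mathbb N$, hence discrete.
   Context: Foundation: intensional Martin-Löf type theory as in the HoTT Book, with $\mathbf 0$, $\mathbf 1$ (point $\star$), $\mathbf 2$, $\mathbb N$, $+$, $\Pi$, $\Sigma$, universes, univalence (hence function extensionality), propositional truncation and set quotients. No excluded middle is assumed. $f^{-1}(y):=\Sigma_x(f\,x=y)$; an embedding is a map all of whose fibers are propositions (types with at most one element). A type is discrete if it has decidable equality. $Y$ is a retract of $X$ if there are $r:X\to Y$, $s:Y\to X$ with $r\circ s$ the identity. Ordinals. An ordinal is a type with a proposition-valued, transitive, extensional (elements with the same predecessors are equal), well-founded (every element accessible) relation $<$; the same symbol denotes an ordinal and its underlying type. It is trichotomous if for all $x,y$ we have $x<y$ or $x=y$ or $y<x$. $\mathbf 1$ is an ordinal with the empty order; $\omega$ is $\mathbb N$ with its usual order. A topped ordinal is an ordinal with a specified point $t$ such that $\neg(t<y)$ for all $y$; $\mathrm{Ord}^\top$ is the type of topped ordinals (in a base universe). For a topped ordinal $\tau$ and a family $\upsilon:\tau\to\mathrm{Ord}^\top$, $\Sigma_\tau\upsilon$ is the topped ordinal $\Sigma_{x:\tau}\upsilon\,x$ with the lexicographic order: $(x,a)<(x',a')$ iff $x<x'$, or there is $r:x=x'$ such that the transport of $a$ along $r$ is below $a'$; its top is the pair of the top of $\tau$ with the top of the fiber over it. The sum $\tau+\upsilon$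 of topped ordinals is the lexicographic sum, over the two-point topped ordinal with underlying type $\mathbf 1+\mathbf 1$ and $\mathrm{inl}\,\star<\mathrm{inr}\,\star$, of the family with members $\tau,\upsilon$. The topped ordinal $\omega+\mathbf 1$ has underlying type $\mathbb N+\mathbf 1$, the usual order on $\mathbb N$ and the added point $\mathrm{inr}\,\star$ above all $\mathrm{inl}\,n$, as top. Extension: for an embedding $j:X\hookrightarrow K$ and $\alpha:X\to\mathrm{Ord}^\top$, $(\alpha/j)\,k:=\prod_{(x,p):j^{-1}(k)}\alpha\,x$ with order $u<v:\equiv\Sigma_{p:j^{-1}(k)}\,u\,p<v\,p$ and top the function assigning tops. Brouwer codes: $\mathrm B$ is the inductive type with constructors $\mathsf Z:\mathrm B$, $\mathsf S:\mathrm B\to\mathrm B$, $\mathsf L:(\mathbb N\to\mathrm B)\to\mathrm B$. The discrete interpretation $[\![-]\!]_{\Sigma_1}:\mathrm B\to\mathrm{Ord}^\top$ is defined by induction: $\mathsf Z\mapsto\mathbf 1$; $\mathsf S\,b\mapsto[\![b]\!]_{\Sigma_1}+\mathbf 1$; $\mathsf L\,b\mapsto\Sigma_{\omega+\mathbf 1}\big((n\mapsto[\![b\,n]\!]_{\Sigma_1})/\mathrm{inl}\big)$, where $\mathrm{inl}:\mathbb N\hookrightarrow\mathbb N+\mathbf 1$. *)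

(* Defs.v *)
From Stdlib Require Import FunctionalExtensionality CRelationClasses.
From Stdlib Require Import PeanoNat Peano_dec Eqdep_dec.

Set Implicit Arguments.
Unset Strict Implicit.

(* Identity types are rendered by the inductive [eq], whose elimination into
   [Type] gives full path induction.  Orders, accessibility, disjunctions and
   existence are valued in [Type], so that, as in type theory, nothing is
   truncated.  Of the axioms, only function extensionality is used. *)

Definition is_prop (A : Type) : Type := forall x y : A, x = y.

Definition is_set (A : Type) : Type := forall x y : A, is_prop (x = y).

Definition transport {A : Type} (P : A -> Type) {x y : A} (r : x = y) (a : P x) : P y :=
  eq_rect x P a y r.
Arguments transport {A} P {x y} r a.

Definition fiber {X K : Type} (f : X -> K) (k : K) : Type := {x : X & f x = k}.

Definition is_embedding {X K : Type} (f : X -> K) : Type :=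
  forall k : K, is_prop (fiber f k).

Definition discrete (X : Type) : Type := forall x y : X, {x = y} + {x <> y}.

Definition retract_of (Y X : Type) : Type :=
  {r : X -> Y & {s : Y -> X & forall y : Y, r (s y) = y}}.

(** * Ordinals *)

Inductive acc {X : Type} (R : crelation X) (x : X) : Type :=
  acc_intro : (forall y : X, R y x -> acc R y) -> acc R x.

Definition well_founded_rel {X : Type} (R : crelation X) : Type :=
  forall x : X, acc R x.

Definition prop_valued {X : Type} (R : crelation X) : Type :=
  forall x y : X, is_prop (R x y).

Definition extensional {X : Type} (R : crelation X) : Type :=
  forall x y : X, (forall z : X, iffT (R z x) (R z y)) -> x = y.

Definition transitive_rel {X : Type} (R : crelation X) : Type :=
  forall x y z : X, R x y -> R y z -> R x z.

Record ordinal : Type := Ordinal {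
  carrier :> Type;
  olt : crelation carrier;
  olt_prop : prop_valued olt;
  olt_trans : transitive_rel olt;
  olt_ext : extensional olt;
  olt_wf : well_founded_rel olt
}.

Definition is_top (A : ordinal) (t : A) : Type := forall y : A, notT (olt t y).

Record topped_ordinal : Type := ToppedOrdinal {
  ord :> ordinal;
  otop : ord;
  otopP : is_top otop
}.

Definition trichotomous (A : ordinal) : Type :=
  forall x y : A, (olt x y + ((x = y) + olt y x))%type.

Lemma acc_irrefl (X : Type) (R : crelation X) (x : X) : acc R x -> R x x -> False.
Proof. intros a. induction a as [x _ IH]. intros h. exact (IH x h h). Qed.

Lemma olt_irrefl (A : ordinal) (x : A) : olt x x -> False.
Proof. exact (acc_irrefl (olt_wf x)). Qed.

Lemma collapsible_is_set (X : Type) (f : forall x y : X, x = y -> x = y) :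
  (forall (x y : X) (p q : x = y), f x y p = f x y q) -> is_set X.
Proof.
intros fc x y p q.
assert (E : forall r : x = y, r = eq_trans (eq_sym (f x x eq_refl)) (f x y r)).
{ intros r. destruct r. symmetry. apply eq_trans_sym_inv_l. }
rewrite (E p), (E q), (fc x y p q). reflexivity.
Qed.

Lemma discrete_is_set (X : Type) : discrete X -> is_set X.
Proof. intros d x y p q. apply (UIP_dec d). Qed.

Lemma ordinal_is_set (A : ordinal) : is_set A.
Proof.
pose (g := fun (x y : A) (p : x = y) (z : A) =>
  (fun l => transport (fun w => olt z w) p l,
   fun l => transport (fun w => olt z w) (eq_sym p) l) : iffT (olt z x) (olt z y)).
apply (collapsible_is_set (f := fun x y p => olt_ext (g x y p))).
intros x y p q. f_equal.
apply functional_extensionality_dep. intros z. unfold g.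
f_equal; apply functional_extensionality; intros l; apply olt_prop.
Qed.

(** * The one-point and two-point ordinals and [omega + 1] *)

Definition one_ordinal : ordinal.
Proof.
refine (@Ordinal unit (fun _ _ => False) _ _ _ _).
- intros x y p; destruct p.
- intros x y z p; destruct p.
- intros [] [] _; reflexivity.
- intros x; constructor; intros y p; destruct p.
Defined.

Definition one_topped : topped_ordinal := @ToppedOrdinal one_ordinal tt (fun _ p => p).

Definition two_lt (x y : unit + unit) : Type :=
  match x, y with
  | inl _, inr _ => True
  | _, _ => False
  end.

Definition two_ordinal : ordinal.
Proof.
refine (@Ordinal (unit + unit) two_lt _ _ _ _).
- intros [x|x] [y|y] p q; destruct p, q; reflexivity.
- intros [x|x] [y|y] [z|z] p q; destruct p, q; exact I.
- intros [[]|[]] [[]|[]] h; try reflexivity.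
  + destruct (snd (h (inl tt)) I).
  + destruct (fst (h (inl tt)) I).
- assert (a : forall u, acc two_lt (inl u)).
  { intros u; constructor; intros [y|y] p; destruct p. }
  intros [x|x]; [apply a|].
  constructor; intros [y|y] p; [apply a|destruct p].
Defined.

Definition two_topped : topped_ordinal.
Proof.
refine (@ToppedOrdinal two_ordinal (inr tt) _).
intros [y|y] p; exact p.
Defined.

Definition omega1_lt (x y : nat + unit) : Type :=
  match x, y with
  | inl n, inl m => n < m
  | inl _, inr _ => True
  | inr _, _ => False
  end.

Definition omega1_ordinal : ordinal.
Proof.
refine (@Ordinal (nat + unit) omega1_lt _ _ _ _).
- intros [x|x] [y|y] p q; simpl in p, q.
  + apply le_unique.
  + destruct p, q; reflexivity.
  + destruct p.
  + destruct p.
- intros [x|x] [y|y] [z|z] p q; simpl in p, q; try destruct p; try destruct q;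
    simpl; try exact I; eauto using Nat.lt_trans.
- intros [x|[]] [y|[]] h.
  + f_equal. destruct (Nat.lt_trichotomy x y) as [l|[l|l]]; trivial; exfalso.
    * exact (Nat.lt_irrefl x (snd (h (inl x)) l)).
    * exact (Nat.lt_irrefl y (fst (h (inl y)) l)).
  + exfalso. exact (Nat.lt_irrefl x (snd (h (inl x)) I)).
  + exfalso. exact (Nat.lt_irrefl y (fst (h (inl y)) I)).
  + reflexivity.
- assert (a : forall n, acc omega1_lt (inl n)).
  { intros n. induction (Nat.lt_wf_0 n) as [n _ IH].
    constructor; intros [m|m] p; [exact (IH m p)|destruct p]. }
  intros [n|u]; [apply a|].
  constructor; intros [m|m] p; [apply a|destruct p].
Defined.

Definition omega1_topped : topped_ordinal.
Proof.
refine (@ToppedOrdinal omega1_ordinal (inr tt) _).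
intros y p; exact p.
Defined.

(** * Lexicographic sums of topped ordinals *)

Section Sigma.

Context (T : topped_ordinal) (U : T -> topped_ordinal).

Definition sigma_lt (u v : {x : T & U x}) : Type :=
  (olt (projT1 u) (projT1 v) +
   {r : projT1 u = projT1 v &
      olt (transport (fun x => U x) r (projT2 u)) (projT2 v)})%type.

Lemma sigma_lt_prop : prop_valued sigma_lt.
Proof.
intros [x a] [y b] p q; unfold sigma_lt in p, q; simpl in *.
destruct p as [p|[r p]], q as [q|[s q]].
- f_equal. apply olt_prop.
- exfalso. clear q. destruct s. exact (olt_irrefl p).
- exfalso. clear p. destruct r. exact (olt_irrefl q).
- destruct (ordinal_is_set r s). f_equal. f_equal. apply olt_prop.
Qed.

Lemma sigma_lt_trans : transitive_rel sigma_lt.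
Proof.
intros [x a] [y b] [z c] p q; unfold sigma_lt in *; simpl in *.
destruct p as [p|[r p]], q as [q|[s q]].
- left. exact (olt_trans p q).
- left. destruct s. exact p.
- left. destruct r. exact q.
- right. destruct s, r. exists eq_refl. exact (olt_trans p q).
Qed.

Lemma sigma_lt_same (x : T) (a b : U x) :
  sigma_lt (existT _ x a) (existT _ x b) -> olt a b.
Proof.
intros [p|[r p]]; simpl in *.
- destruct (olt_irrefl p).
- rewrite (ordinal_is_set r eq_refl) in p. exact p.
Qed.

Lemma sigma_lt_top (x y : T) (b : U y) :
  sigma_lt (existT _ x (otop (U x))) (existT _ y b) -> olt x y.
Proof.
intros [p|[r p]]; simpl in *.
- exact p.
- destruct r. destruct (otopP p).
Qed.

Lemma sigma_lt_ext : extensional sigma_lt.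
Proof.
intros [x a] [y b] h.
assert (e : x = y).
{ apply olt_ext. intros z. split; intros l; eapply sigma_lt_top.
  - apply h. left. exact l.
  - apply h. left. exact l. }
destruct e. f_equal. apply olt_ext. intros c.
split; intros l; apply sigma_lt_same, h; right; exists eq_refl; exact l.
Qed.

Lemma sigma_lt_wf : well_founded_rel sigma_lt.
Proof.
intros [x a]. revert a. induction (olt_wf x) as [x _ IHx].
intros a. induction (olt_wf a) as [a _ IHa].
constructor. intros [y b] [p|[r p]]; simpl in *.
- exact (IHx y p b).
- destruct r. exact (IHa b p).
Qed.

Definition sigma_ordinal : ordinal :=
  Ordinal sigma_lt_prop sigma_lt_trans sigma_lt_ext sigma_lt_wf.

Definition sigma_topped : topped_ordinal.
Proof.
refine (@ToppedOrdinal sigma_ordinal (existT _ (otop T) (otop (U (otop T)))) _).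
intros [y b] [p|[r p]]; simpl in *.
- exact (otopP p).
- destruct r. exact (otopP p).
Defined.

End Sigma.

Definition add_topped (A B : topped_ordinal) : topped_ordinal :=
  sigma_topped (T := two_topped)
    (fun i : unit + unit => match i with inl _ => A | inr _ => B end).

(** * Extension of a family of topped ordinals along an embedding *)

Section Extension.

Context {X K : Type} (j : X -> K) (j_emb : is_embedding j)
  (A : X -> topped_ordinal) (k : K).

Definition ext_carrier : Type := forall p : fiber j k, A (projT1 p).

Definition ext_lt (u v : ext_carrier) : Type := {p : fiber j k & olt (u p) (v p)}.

Lemma ext_lt_at (u v : ext_carrier) (p : fiber j k) : ext_lt u v -> olt (u p) (v p).
Proof. intros [q l]. destruct (j_emb q p). exact l. Qed.

Lemma ext_lt_prop : prop_valued ext_lt.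
Proof.
intros u v [p l] [q m]. destruct (j_emb p q). f_equal. apply olt_prop.
Qed.

Lemma ext_lt_trans : transitive_rel ext_lt.
Proof.
intros u v w [p l] m. exists p. exact (olt_trans l (ext_lt_at p m)).
Qed.

Definition ext_const (p : fiber j k) (a : A (projT1 p)) : ext_carrier :=
  fun q => transport (fun q => A (projT1 q)) (j_emb p q) a.

Lemma fiber_is_set : is_set (fiber j k).
Proof.
apply (collapsible_is_set (f := fun p q _ => j_emb p q)). reflexivity.
Qed.

Lemma ext_constE (p : fiber j k) (a : A (projT1 p)) : ext_const a p = a.
Proof.
unfold ext_const. rewrite (fiber_is_set (j_emb p p) eq_refl). reflexivity.
Qed.

Lemma ext_lt_ext : extensional ext_lt.
Proof.
intros u v h. apply functional_extensionality_dep. intros p.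
apply olt_ext. intros a. rewrite <- (ext_constE a).
split; intros l; apply ext_lt_at, h; exists p; exact l.
Qed.

Lemma ext_lt_wf : well_founded_rel ext_lt.
Proof.
assert (H : forall (p : fiber j k) (a : A (projT1 p)), acc (@olt _) a ->
            forall u : ext_carrier, u p = a -> acc ext_lt u).
{ intros p a ha. induction ha as [a _ IH]. intros u e.
  constructor. intros v l. apply (IH (v p)); [|reflexivity].
  rewrite <- e. exact (ext_lt_at p l). }
intros u. constructor. intros v [p l].
exact (H p (v p) (olt_wf (v p)) v eq_refl).
Qed.

Definition ext_ordinal : ordinal :=
  Ordinal ext_lt_prop ext_lt_trans ext_lt_ext ext_lt_wf.

Definition ext_topped : topped_ordinal.
Proof.
refine (@ToppedOrdinal ext_ordinal (fun p => otop (A (projT1 p))) _).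
intros v [p l]. exact (otopP l).
Defined.

End Extension.

Lemma inl_embedding : is_embedding (inl : nat -> nat + unit).
Proof.
assert (d : discrete (nat + unit)).
{ intros x y. repeat decide equality. }
intros k [n p] [m q].
assert (e : n = m) by congruence.
destruct e. f_equal. apply (discrete_is_set d).
Qed.

(** * Brouwer codes and their discrete interpretation *)

Inductive brouwer : Type :=
| BZ : brouwer
| BS : brouwer -> brouwer
| BL : (nat -> brouwer) -> brouwer.

Fixpoint sigma1 (b : brouwer) : topped_ordinal :=
  match b with
  | BZ => one_topped
  | BS b => add_topped (sigma1 b) one_topped
  | BL f => sigma_topped (T := omega1_topped)
             (ext_topped inl_embedding (fun n : nat => sigma1 (f n)))
  end.

(* Main.v *)
Require Import Defs.
From Stdlib Require Import FunctionalExtensionality PeanoNat Compare_dec Cantor.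

(** Both properties are proved by induction on the code, because each is
    preserved by the two constructions that interpret the constructors:
    lexicographic sums and extensions along an embedding.

    Lexicographic sums preserve trichotomy and the property of being a retract
    of [nat] without further hypotheses ([sigma_trichotomous],
    [sigma_retract_nat]).  The extension of a family along [j] behaves well at
    [k] as soon as one can decide whether [k] is in the image of [j]: if
    [j x = k] then, the fiber being a proposition, the product over it is
    just the member of the family at [x]; if the fiber is empty the product has
    exactly one element ([ext_trichotomous], [ext_retract_nat]).  For the
    embedding [inl : nat -> nat + unit] this decision is a case distinction, so
    no excluded middle enters.  Discreteness then follows from that of [nat]. *)

Lemma retract_discrete (Y X : Type) : retract_of Y X -> discrete X -> discrete Y.
Proof.
intros [r [s rs]] d x y.
destruct (d (s x) (s y)) as [e|n].
- left. rewrite <- (rs x), <- (rs y), e. reflexivity.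
- right. intros e. apply n. rewrite e. reflexivity.
Qed.

Lemma sigma_trichotomous (T : topped_ordinal) (U : T -> topped_ordinal) :
  trichotomous T -> (forall x, trichotomous (U x)) ->
  trichotomous (sigma_topped U).
Proof.
intros tT tU [x a] [y b].
destruct (tT x y) as [l|[e|l]].
- left. left. exact l.
- destruct e. destruct (tU x a b) as [l|[e|l]].
  + left. right. exists eq_refl. exact l.
  + right. left. destruct e. reflexivity.
  + right. right. right. exists eq_refl. exact l.
- right. right. left. exact l.
Qed.

(** A pair is coded by the Cantor code of the codes of its components; decoding
    the first component determines which fiber to decode the second one in. *)
Lemma sigma_retract_nat (T : topped_ordinal) (U : T -> topped_ordinal) :
  retract_of T nat -> (forall x, retract_of (U x) nat) ->
  retract_of (sigma_topped U) nat.
Proof.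
intros [r [s rs]] rU.
exists (fun n => let c := Cantor.of_nat n in
  existT (fun x => U x) (r (fst c)) (projT1 (rU (r (fst c))) (snd c))).
exists (fun u => Cantor.to_nat
  (s (projT1 u), projT1 (projT2 (rU (projT1 u))) (projT2 u))).
intros [x a]. cbv zeta. rewrite Cantor.cancel_of_to. simpl.
rewrite (rs x). f_equal. apply (projT2 (projT2 (rU x))).
Qed.

Section DecidableFiber.

Context {X K : Type} (j : X -> K) (j_emb : is_embedding j)
  (A : X -> topped_ordinal) (k : K)
  (fiber_dec : (fiber j k + notT (fiber j k))%type).

Lemma ext_trichotomous :
  (forall x, trichotomous (A x)) -> trichotomous (ext_topped j_emb A k).
Proof.
intros tA u v.
destruct fiber_dec as [p|n].
- destruct (tA _ (u p) (v p)) as [l|[e|l]].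
  + left. exists p. exact l.
  + right. left. apply functional_extensionality_dep. intros q.
    destruct (j_emb k p q). exact e.
  + right. right. exists p. exact l.
- right. left. apply functional_extensionality_dep. intros q. destruct (n q).
Qed.

Lemma ext_retract_nat :
  (forall x, retract_of (A x) nat) -> retract_of (ext_topped j_emb A k) nat.
Proof.
intros rA.
destruct fiber_dec as [p|n].
- destruct (rA (projT1 p)) as [r [s rs]].
  exists (fun n => ext_const j_emb (r n)), (fun u => s (u p)).
  intros u. apply functional_extensionality_dep. intros q.
  destruct (j_emb k p q). rewrite ext_constE. apply rs.
- exists (fun _ q => False_rect _ (n q)), (fun _ => 0).
  intros u. apply functional_extensionality_dep. intros q. destruct (n q).
Qed.

End DecidableFiber.

Lemma inl_fiber_dec (k : nat + unit) :
  (fiber (inl : nat -> nat + unit) k + notT (fiber (inl : nat -> nat + unit) k))%type.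
Proof.
destruct k as [n|u].
- left. exists n. reflexivity.
- right. intros [n e]. discriminate e.
Qed.

Lemma one_trichotomous : trichotomous one_topped.
Proof. intros [] []. right. left. reflexivity. Qed.

Lemma two_trichotomous : trichotomous two_topped.
Proof.
intros [[]|[]] [[]|[]].
- right. left. reflexivity.
- left. exact I.
- right. right. exact I.
- right. left. reflexivity.
Qed.

Lemma omega1_trichotomous : trichotomous omega1_topped.
Proof.
intros [n|[]] [m|[]].
- destruct (lt_eq_lt_dec n m) as [[l|e]|l].
  + left. exact l.
  + right. left. destruct e. reflexivity.
  + right. right. exact l.
- left. exact I.
- right. right. exact I.
- right. left. reflexivity.
Qed.

Lemma one_retract_nat : retract_of one_topped nat.
Proof. exists (fun _ => tt), (fun _ => 0). intros []. reflexivity. Qed.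

Lemma two_retract_nat : retract_of two_topped nat.
Proof.
exists (fun n => match n with 0 => inl tt | S _ => inr tt end).
exists (fun x : unit + unit => match x with inl _ => 0 | inr _ => 1 end).
intros [[]|[]]; reflexivity.
Qed.

Lemma omega1_retract_nat : retract_of omega1_topped nat.
Proof.
exists (fun n => match n with 0 => inr tt | S m => inl m end).
exists (fun x : nat + unit => match x with inl m => S m | inr _ => 0 end).
intros [m|[]]; reflexivity.
Qed.

Lemma sigma1_trichotomous (b : brouwer) : trichotomous (sigma1 b).
Proof.
induction b as [|b IH|f IH].
- exact one_trichotomous.
- apply sigma_trichotomous; [exact two_trichotomous|].
  intros [i|i]; [exact IH|exact one_trichotomous].
- apply sigma_trichotomous; [exact omega1_trichotomous|].
  intros k. exact (ext_trichotomous _ _ _ _ (inl_fiber_dec k) IH).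
Qed.

Lemma sigma1_retract_nat (b : brouwer) : retract_of (sigma1 b) nat.
Proof.
induction b as [|b IH|f IH].
- exact one_retract_nat.
- apply sigma_retract_nat; [exact two_retract_nat|].
  intros [i|i]; [exact IH|exact one_retract_nat].
- apply sigma_retract_nat; [exact omega1_retract_nat|].
  intros k. exact (ext_retract_nat _ _ _ _ (inl_fiber_dec k) IH).
Qed.

Theorem theorem6p20 (b : brouwer) :
  (trichotomous (sigma1 b) *
   (retract_of (sigma1 b) nat * discrete (sigma1 b)))%type.
Proof.
split; [|split].
- apply sigma1_trichotomous.
- apply sigma1_retract_nat.
- exact (retract_discrete _ _ (sigma1_retract_nat b) Nat.eq_dec).
Qed.
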